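(* Let $n\in\mathbb N_0$. If $X$ is a concrete fibrant cubeset, then the truncation $\tau_nX$ is given by $X/\!\sim_n$ and the unit $\eta_X\colon X\to\tau_nX$ is a surjective fibration. In particular, $\tau_nX$ is concrete and fibrant.
   Context: The cube category $\Box$ has objects $\{0,1\}^n$ ($n\in\mathbb N_0$) and morphisms the maps $\{0,1\}^n\to\{0,1\}^m$ that are restrictions of affine linear maps $\mathbb Z^n\to\mathbb Z^m$. A cubeset is a presheaf of sets $X$ on $\Box$; $X(n)$ is its value on $\{0,1\}^n$ and $\Box^n$ the presheaf represented by $\{0,1\}^n$. For $n\ge1$ the corner $\Lambda^n\subseteq\Box^n$ is the union of the images of the maps $\varepsilon_i\colon\Box^{n-1}\to\Box^n$, $1\le i\le n$, inserting a $0$ at coordinate $i$. $X$ is concrete if $X(n)\to X(0)^{\{0,1\}^n}$ (taking vertices) is injective for all $n$. A map of cubesets is a fibration if it has the right lifting property against all inclusions $\Lambda^n\to\Box^n$, $n\ge1$, and $X$ is fibrant if $X\to*$ is a fibration. $X$ is $n$-step if $\mathrm{Hom}(\Box^k,X)\to\mathrm{Hom}(\Lambda^k,X)$ is bijective for all $k>n$. $\tau_n$ is the left adjoint of the inclusion of the full subcategory of $n$-step cubesets into all cubesets. For $x,y\in X(0)$ put $x\sim_ny$ iff there exist $c,c'\in X(n+1)$ with $c|_{\Lambda^{n+1}}=c'|_{\Lambda^{n+1}}$, $c(1^{n+1})=x$ and $c'(1^{n+1})=y$. For $X$ concrete fibrant this is an equivalence relation on $X(0)$. $X/\!\sim_n$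 is the cubeset whose set of $m$-cubes is the image of $X(m)$ under $X(m)\to X(0)^{2^m}\to(X(0)/\!\sim_n)^{2^m}$; there is a quotient map $X\to X/\!\sim_n$, and the identification of $\tau_nX$ with $X/\!\sim_n$ is compatible with it and $\eta_X$. *)

(* Defs.v *)
(* [boolp] supplies functional and propositional extensionality, so that
   morphisms of cubes and maps of cubesets are compared by [=]. *)
From mathcomp Require Import all_boot all_algebra.
From mathcomp Require Import boolp.

Set Implicit Arguments.
Unset Strict Implicit.
Unset Printing Implicit Defensive.

Import GRing.Theory.
Local Open Scope ring_scope.

(** * The cube category *)

Definition vert (n : nat) := {ffun 'I_n -> bool}.

Definition zvec n (v : vert n) : 'rV[int]_n := \row_i (v i)%:R.

Definition is_affine m n (f : vert m -> vert n) : Prop :=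
  exists (A : 'M[int]_(m, n)) (b : 'rV[int]_n),
    forall v, zvec (f v) = zvec v *m A + b.

Record box_hom (m n : nat) := BoxHom {
  box_fun :> vert m -> vert n;
  box_affine : is_affine box_fun
}.

Lemma box_hom_ext m n (f g : box_hom m n) : (forall v, f v = g v) -> f = g.
Proof.
case: f g => [f fA] [g gA] /= /funext fg; rewrite fg in fA *.
by congr BoxHom; exact: Prop_irrelevance.
Qed.

Lemma is_affine_id n : is_affine (@id (vert n)).
Proof. by exists 1%:M, 0 => v; rewrite mulmx1 addr0. Qed.

Definition box_id n : box_hom n n := BoxHom (@is_affine_id n).

Lemma is_affine_comp l m n (g : vert m -> vert n) (f : vert l -> vert m) :
  is_affine g -> is_affine f -> is_affine (g \o f).
Proof.
move=> [C [d gE]] [A [b fE]]; exists (A *m C), (b *m C + d) => v /=.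
by rewrite gE fE mulmxDl mulmxA addrA.
Qed.

Definition box_comp l m n (g : box_hom m n) (f : box_hom l m) : box_hom l n :=
  BoxHom (is_affine_comp (box_affine g) (box_affine f)).

Lemma box_compA k l m n (h : box_hom m n) (g : box_hom l m) (f : box_hom k l) :
  box_comp (box_comp h g) f = box_comp h (box_comp g f).
Proof. exact: box_hom_ext. Qed.

Lemma box_compf1 m n (f : box_hom m n) : box_comp f (box_id m) = f.
Proof. exact: box_hom_ext. Qed.

Lemma box_comp1f m n (f : box_hom m n) : box_comp (box_id n) f = f.
Proof. exact: box_hom_ext. Qed.

Lemma is_affine_cst m n (v : vert n) : is_affine (fun _ : vert m => v).
Proof. by exists 0, (zvec v) => w; rewrite mulmx0 add0r. Qed.

Definition box_vertex n (v : vert n) : box_hom 0 n := BoxHom (is_affine_cst 0 v).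

Definition insert0 n (i : 'I_n.+1) (v : vert n) : vert n.+1 :=
  [ffun j => if unlift i j is Some k then v k else false].

Lemma is_affine_insert0 n (i : 'I_n.+1) : is_affine (insert0 i).
Proof.
exists (\matrix_(k, j) (lift i k == j)%:R), 0 => v.
apply/rowP => j; rewrite addr0 !mxE ffunE.
case: unliftP => [k ->|->].
  rewrite (bigD1 k) //= !mxE eqxx mulr1 big1 ?addr0 // => l lk.
  by rewrite !mxE (inj_eq lift_inj) (negbTE lk) mulr0.
by rewrite big1 // => l _; rewrite !mxE eq_sym (negbTE (neq_lift _ _)) mulr0.
Qed.

Definition face n (i : 'I_n.+1) : box_hom n n.+1 := BoxHom (is_affine_insert0 i).

(** * Cubesets *)

Record cubeset := Cubeset {
  cells :> nat -> Type;
  restr : forall m n, box_hom m n -> cells n -> cells m;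
  restr_id : forall n (x : cells n), restr (box_id n) x = x;
  restr_comp : forall l m n (g : box_hom m n) (f : box_hom l m) (x : cells n),
    restr (box_comp g f) x = restr f (restr g x)
}.

Record cubeset_map (X Y : cubeset) := CubesetMap {
  app :> forall n, X n -> Y n;
  app_restr : forall m n (f : box_hom m n) (x : X n),
    app (restr f x) = restr f (app x)
}.

Lemma cubeset_map_ext X Y (f g : cubeset_map X Y) :
  (forall n (x : X n), f n x = g n x) -> f = g.
Proof.
case: f g => [f fN] [g gN] /= fg.
have {}fg : f = g by apply: functional_extensionality_dep => n; apply: funext.
by rewrite fg in fN *; congr CubesetMap; exact: Prop_irrelevance.
Qed.

Definition idmap (X : cubeset) : cubeset_map X X :=
  @CubesetMap X X (fun n x => x) (fun m n f x => erefl).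

Lemma compmap_subproof (X Y Z : cubeset) (g : cubeset_map Y Z)
    (f : cubeset_map X Y) m n (h : box_hom m n) (x : X n) :
  g m (f m (restr h x)) = restr h (g n (f n x)).
Proof. by rewrite !app_restr. Qed.

Definition compmap X Y Z (g : cubeset_map Y Z) (f : cubeset_map X Y) :
  cubeset_map X Z := CubesetMap (compmap_subproof g f).

Definition is_iso X Y (f : cubeset_map X Y) : Prop :=
  exists g : cubeset_map Y X, compmap g f = idmap X /\ compmap f g = idmap Y.

Definition surjective_map X Y (f : cubeset_map X Y) : Prop :=
  forall m (y : Y m), exists x : X m, f m x = y.

Definition point : cubeset :=
  @Cubeset (fun _ => unit) (fun _ _ _ x => x) (fun _ _ => erefl)
    (fun _ _ _ _ _ _ => erefl).

Definition to_point X : cubeset_map X point :=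
  @CubesetMap X point (fun _ _ => tt) (fun _ _ _ _ => erefl).

Definition box (n : nat) : cubeset :=
  @Cubeset (fun m => box_hom m n) (fun _ _ f g => box_comp g f)
    (fun m f => box_compf1 f) (fun _ _ _ g f h => esym (box_compA h g f)).

Definition yoneda (X : cubeset) n (c : X n) : cubeset_map (box n) X :=
  @CubesetMap (box n) X (fun m f => restr f c)
    (fun l m f g => restr_comp g f c).

(** * Corners and fibrations *)

Definition in_corner n m (f : box_hom m n.+1) : Prop :=
  exists (i : 'I_n.+1) (g : box_hom m n), f = box_comp (face i) g.

Lemma in_corner_comp n l m (f : box_hom l m) (g : box_hom m n.+1) :
  in_corner g -> in_corner (box_comp g f).
Proof.
by move=> [i [h ->]]; exists i, (box_comp h f); rewrite box_compA.
Qed.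

Definition corner_restr n l m (f : box_hom l m)
    (g : {g : box_hom m n.+1 | in_corner g}) :
    {g : box_hom l n.+1 | in_corner g} :=
  exist _ (box_comp (sval g) f) (in_corner_comp f (svalP g)).

Lemma corner_ext n m (g h : {g : box_hom m n.+1 | in_corner g}) :
  sval g = sval h -> g = h.
Proof. exact: eq_sig_hprop (fun _ => @Prop_irrelevance _) _ _. Qed.

Lemma corner_restr_id n m (g : {g : box_hom m n.+1 | in_corner g}) :
  corner_restr (box_id m) g = g.
Proof. by apply: corner_ext; exact: box_compf1. Qed.

Lemma corner_restr_comp n k l m (g : box_hom l m) (f : box_hom k l)
    (h : {h : box_hom m n.+1 | in_corner h}) :
  corner_restr (box_comp g f) h = corner_restr f (corner_restr g h).
Proof. by apply: corner_ext; rewrite /= box_compA. Qed.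

(* [corner n] is the corner of the cube of dimension [n.+1]: corners exist in
   positive dimension only. *)
Definition corner (n : nat) : cubeset :=
  Cubeset (@corner_restr_id n) (@corner_restr_comp n).

Definition corner_incl n : cubeset_map (corner n) (box n.+1) :=
  @CubesetMap (corner n) (box n.+1) (fun m g => sval g) (fun _ _ _ _ => erefl).

Definition has_rlp A B (i : cubeset_map A B) X Y (p : cubeset_map X Y) : Prop :=
  forall (a : cubeset_map A X) (b : cubeset_map B Y),
    compmap p a = compmap b i ->
    exists l : cubeset_map B X, compmap l i = a /\ compmap p l = b.

Definition fibration X Y (p : cubeset_map X Y) : Prop :=
  forall n, has_rlp (corner_incl n) p.

Definition fibrant (X : cubeset) : Prop := fibration (to_point X).

Definition vertices (X : cubeset) n (c : X n) : vert n -> X 0%N :=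
  fun v => restr (box_vertex v) c.

Definition concrete (X : cubeset) : Prop :=
  forall n, injective (@vertices X n).

Definition corner_restriction (X : cubeset) n (s : cubeset_map (box n.+1) X) :
  cubeset_map (corner n) X := compmap s (corner_incl n).

Definition n_step (n : nat) (X : cubeset) : Prop :=
  forall k, (n < k.+1)%N -> bijective (@corner_restriction X k).

(** * Truncation *)

(* A left adjoint of the inclusion of the full subcategory of n-step cubesets,
   presented by its action, its unit, and the adjunction bijection
   Hom(tau X, Y) = Hom(X, Y) given by precomposition with the unit. *)
Record truncation (n : nat) := Truncation {
  tau :> cubeset -> cubeset;
  tau_n_step : forall X, n_step n (tau X);
  tau_map : forall X Y, cubeset_map X Y -> cubeset_map (tau X) (tau Y);
  tau_map_id : forall X, tau_map (idmap X) = idmap (tau X);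
  tau_map_comp : forall X Y Z (g : cubeset_map Y Z) (f : cubeset_map X Y),
    tau_map (compmap g f) = compmap (tau_map g) (tau_map f);
  tau_unit : forall X, cubeset_map X (tau X);
  tau_unit_natural : forall X Y (f : cubeset_map X Y),
    compmap (tau_unit Y) f = compmap (tau_map f) (tau_unit X);
  tau_adjoint : forall X Y, n_step n Y ->
    bijective (fun g : cubeset_map (tau X) Y => compmap g (tau_unit X))
}.

(** * The quotient by the relation ~_n *)

Definition top_vertex n : vert n := [ffun => true].

Definition sim (n : nat) (X : cubeset) (x y : X 0%N) : Prop :=
  exists c c' : X n.+1,
    [/\ corner_restriction (yoneda c) = corner_restriction (yoneda c'),
        vertices c (top_vertex n.+1) = x &
        vertices c' (top_vertex n.+1) = y].

(* The set X(0)/~_n of classes. [sim] is an equivalence relation when X is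
   concrete and fibrant, which is the only case of interest. *)
Definition sim_quot (n : nat) (X : cubeset) :=
  {P : X 0%N -> Prop | exists x, P = sim n x}.

Definition sim_class n (X : cubeset) (x : X 0%N) : sim_quot n X :=
  exist _ (sim n x) (ex_intro _ x erefl).

Definition quot_vertices n (X : cubeset) m (x : X m) : vert m -> sim_quot n X :=
  fun v => sim_class n (vertices x v).

Definition quot_cells n (X : cubeset) m :=
  {c : vert m -> sim_quot n X | exists x : X m, c = quot_vertices n x}.

Lemma quot_vertices_restr n (X : cubeset) l m (f : box_hom l m) (x : X m) :
  quot_vertices n (restr f x) = quot_vertices n x \o f.
Proof.
apply: funext => v /=; rewrite /quot_vertices /vertices -restr_comp.
by congr (sim_class n (restr _ x)); exact: box_hom_ext.
Qed.

Lemma quot_restr_subproof n (X : cubeset) l m (f : box_hom l m) (c : quot_cells n X m) :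
  exists x : X l, sval c \o f = quot_vertices n x.
Proof.
by have [x ->] := svalP c; exists (restr f x); rewrite quot_vertices_restr.
Qed.

Definition quot_restr n (X : cubeset) l m (f : box_hom l m) (c : quot_cells n X m) :
  quot_cells n X l := exist _ (sval c \o f) (quot_restr_subproof f c).

Lemma quot_cells_ext n (X : cubeset) m (c d : quot_cells n X m) : sval c = sval d -> c = d.
Proof. exact: eq_sig_hprop (fun _ => @Prop_irrelevance _) _ _. Qed.

Lemma quot_restr_id n (X : cubeset) m (c : quot_cells n X m) : quot_restr (box_id m) c = c.
Proof. exact: quot_cells_ext. Qed.

Lemma quot_restr_comp n (X : cubeset) k l m (g : box_hom l m) (f : box_hom k l)
    (c : quot_cells n X m) :
  quot_restr (box_comp g f) c = quot_restr f (quot_restr g c).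
Proof. exact: quot_cells_ext. Qed.

Definition quotient (n : nat) (X : cubeset) : cubeset :=
  Cubeset (@quot_restr_id n X) (@quot_restr_comp n X).

Lemma quotient_map_subproof n (X : cubeset) l m (f : box_hom l m) (x : X m) :
  exist _ (quot_vertices n (restr f x)) (ex_intro _ _ erefl) =
  restr f (exist _ (quot_vertices n x) (ex_intro _ x erefl) : quotient n X m).
Proof. by apply: quot_cells_ext; exact: quot_vertices_restr. Qed.

Definition quotient_map (n : nat) (X : cubeset) :
    cubeset_map X (quotient n X) :=
  @CubesetMap X (quotient n X)
    (fun m x => exist _ (quot_vertices n x) (ex_intro _ x erefl))
    (fun l m f x => quotient_map_subproof n f x).

(** * Existence of the truncation *)

(* The left adjoint exists, so that quantifying over [truncation n] is not
   vacuous. It is built by freely adding to X fillers of corners of dimension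
   > n, as terms, and dividing by the congruence [teq] that makes these fillers
   solve their corner problem uniquely. *)
Section Existence.
Variable n : nat.

Section Construction.
Variable X : cubeset.

Inductive term : nat -> Type :=
| tin m of X m : term m
| tfill k m of (n < k.+1)%N & (forall j, corner k j -> term j) &
    box_hom m k.+1 : term m.

Definition tres l m (f : box_hom l m) (t : term m) : term l :=
  match t in term m return box_hom l m -> term l with
  | tin _ x => fun f => tin (restr f x)
  | tfill _ _ nk b g => fun f => tfill nk b (box_comp g f)
  end f.

Lemma tres_id m (t : term m) : tres (box_id m) t = t.
Proof. by case: t => [? ?|? ? ? ? ?] /=; rewrite ?restr_id ?box_compf1. Qed.

Lemma tres_comp k l m (g : box_hom l m) (f : box_hom k l) (t : term m) :
  tres (box_comp g f) t = tres f (tres g t).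
Proof.
by case: t g => [? ?|? ? ? ? ?] g /=; rewrite ?restr_comp ?box_compA.
Qed.

Inductive teq : forall m, term m -> term m -> Prop :=
| teq_sym m (s t : term m) : teq s t -> teq t s
| teq_trans m (s t u : term m) : teq s t -> teq t u -> teq s u
| teq_in m (x : X m) : teq (tin x) (tin x)
| teq_fill k m nk (b b' : forall j, corner k j -> term j) (g : box_hom m k.+1) :
    (forall j l, teq (b j l) (b' j l)) ->
    (forall i j (f : box_hom i j) l, teq (tres f (b j l)) (b' i (restr f l))) ->
    teq (tfill nk b g) (tfill nk b' g)
| teq_beta k m nk (b : forall j, corner k j -> term j) (l : corner k m) :
    (forall j l, teq (b j l) (b j l)) ->
    (forall i j (f : box_hom i j) l, teq (tres f (b j l)) (b i (restr f l))) ->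
    teq (tfill nk b (corner_incl k m l)) (b m l)
| teq_eta k m nk (b : forall j, corner k j -> term j) (g : box_hom m k.+1) t :
    teq t t ->
    (forall j l, teq (tres (corner_incl k j l) t) (b j l)) ->
    teq (tfill nk b g) (tres g t).

Lemma teq_refl_l m (s t : term m) : teq s t -> teq s s.
Proof. by move=> st; exact: teq_trans st (teq_sym st). Qed.

Lemma teq_refl_r m (s t : term m) : teq s t -> teq t t.
Proof. by move=> /teq_sym; exact: teq_refl_l. Qed.

Lemma teq_res l m (f : box_hom l m) (s t : term m) :
  teq s t -> teq (tres f s) (tres f t).
Proof.
move=> st; elim: st l f => {m s t}.
- by move=> m s t _ IH l f; exact/teq_sym/IH.
- by move=> m s t u _ IH _ IH' l f; exact: teq_trans (IH l f) (IH' l f).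
- by move=> m x l f; exact: teq_in.
- by move=> k m nk b b' g bb' _ bN _ l f; exact: teq_fill.
- move=> k m nk b c bb _ bN _ l f.
  exact: teq_trans (teq_beta nk (restr f c) bb bN) (teq_sym (bN _ _ f c)).
- by move=> k m nk b g t tt _ tb _ l f; rewrite -tres_comp; exact: teq_eta.
Qed.

Lemma teq_bnd_nat k (b : forall j, corner k j -> term j) (t : term k.+1) :
  (forall j l, teq (tres (corner_incl k j l) t) (b j l)) ->
  forall i j (f : box_hom i j) l, teq (tres f (b j l)) (b i (restr f l)).
Proof.
move=> tb i j f l; apply: teq_trans (tb _ _).
by rewrite [corner_incl k i _]app_restr tres_comp; exact/teq_res/teq_sym/tb.
Qed.

Definition tcells m := {P : term m -> Prop | exists t, teq t t /\ P = teq t}.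

Definition tclass m (t : term m) (tt : teq t t) : tcells m :=
  exist _ (teq t) (ex_intro _ t (conj tt erefl)).

Definition trep m (c : tcells m) : term m := sval (cid (svalP c)).

Lemma trepP m (c : tcells m) : teq (trep c) (trep c).
Proof. by rewrite /trep; case: cid => t []. Qed.

Lemma tclass_eq m (s t : term m) ss tt : @tclass m s ss = @tclass m t tt <-> teq s t.
Proof.
split=> [[st]|st]; first by rewrite st.
apply: eq_sig_hprop => [? ? ?|/=]; first exact: Prop_irrelevance.
apply: funext => u; apply/propext; split=> [|tu]; first exact/teq_trans/teq_sym.
exact: teq_trans st tu.
Qed.

Lemma trepK m (c : tcells m) : tclass (trepP c) = c.
Proof.
apply: eq_sig_hprop => [? ? ?|]; first exact: Prop_irrelevance.
by rewrite /= /trep; case: cid => t [tt cE]; symmetry; exact: cE.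
Qed.

Lemma trep_class m (t : term m) (tt : teq t t) : teq (trep (tclass tt)) t.
Proof. by apply/(tclass_eq (trepP _) tt); exact: trepK. Qed.

Definition tcres l m (f : box_hom l m) (c : tcells m) : tcells l :=
  tclass (teq_res f (trepP c)).

Lemma tcres_class l m (f : box_hom l m) (t : term m) (tt : teq t t) :
  tcres f (tclass tt) = tclass (teq_res f tt).
Proof. by apply/tclass_eq/teq_res/trep_class. Qed.

Lemma tcres_id m (c : tcells m) : tcres (box_id m) c = c.
Proof. by rewrite -{2}(trepK c); apply/tclass_eq; rewrite tres_id; exact: trepP. Qed.

Lemma tcres_comp k l m (g : box_hom l m) (f : box_hom k l) (c : tcells m) :
  tcres (box_comp g f) c = tcres f (tcres g c).
Proof.
rewrite [tcres g c]/tcres tcres_class; apply/tclass_eq; rewrite tres_comp.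
by do 2 apply: teq_res; exact: trepP.
Qed.

Definition trunc : cubeset := Cubeset tcres_id tcres_comp.

Lemma trunc_unit_subproof l m (f : box_hom l m) (x : X m) :
  tclass (teq_in (restr f x)) = restr f (tclass (teq_in x) : trunc m).
Proof. by rewrite [RHS]tcres_class; apply/tclass_eq; exact: teq_in. Qed.

Definition trunc_unit : cubeset_map X trunc :=
  @CubesetMap X trunc (fun m x => tclass (teq_in x)) trunc_unit_subproof.

Lemma box_map_yoneda (Y : cubeset) k (s : cubeset_map (box k) Y) :
  s = yoneda (s k (box_id k)).
Proof.
apply: cubeset_map_ext => m f /=.
by rewrite -app_restr /= box_comp1f.
Qed.

Lemma bijP (A B : Type) (f : A -> B) :
  injective f -> (forall b, exists a, f a = b) -> bijective f.
Proof.
move=> fI fS; have [g gK] := choice fS.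
by exists g => // a; exact: fI.
Qed.

Lemma trunc_n_step : n_step n trunc.
Proof.
move=> k nk; apply: bijP => [s s' /(congr1 (@app _ _)) ss'|phi].
  rewrite (box_map_yoneda s) (box_map_yoneda s').
  set c := s _ _; set c' := s' _ _.
  have cc' j (l : corner k j) :
      teq (tres (corner_incl k j l) (trep c)) (tres (corner_incl k j l) (trep c')).
    apply/(tclass_eq (teq_res _ (trepP c)) (teq_res _ (trepP c'))).
    have /= := congr1 (fun h => h j l) ss'.
    by rewrite (box_map_yoneda s) (box_map_yoneda s').
  congr yoneda; rewrite -(trepK c) -(trepK c'); apply/tclass_eq.
  rewrite -[trep c]tres_id -[trep c']tres_id.
  pose b j (l : corner k j) := tres (corner_incl k j l) (trep c').
  apply: (@teq_trans _ _ (tfill nk b (box_id _))).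
    by apply: teq_sym; apply: teq_eta => //; exact: trepP.
  by apply: teq_eta => [|j l]; [exact: trepP|exact/teq_res/trepP].
pose b j (l : corner k j) := trep (phi j l).
have bb j l : teq (b j l) (b j l) by exact: trepP.
have bN i j (f : box_hom i j) l : teq (tres f (b j l)) (b i (restr f l)).
  rewrite /b app_restr /=; exact/teq_sym/trep_class.
have tt : teq (tfill nk b (box_id _)) (tfill nk b (box_id _)) by exact: teq_fill.
exists (yoneda (tclass tt : trunc k.+1)); apply: cubeset_map_ext => j l /=.
rewrite tcres_class -[RHS]trepK; apply/tclass_eq => /=.
by rewrite box_comp1f; exact: teq_beta.
Qed.

Section Universal.
Variables (Y : cubeset) (Ystep : n_step n Y) (f : cubeset_map X Y).

Fixpoint teval m (t : term m) : Y m -> Prop :=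
  match t in term m return Y m -> Prop with
  | tin _ x => fun y => y = f _ x
  | tfill k m _ b g => fun y => exists c : Y k.+1,
      (forall j l, teval (b j l) (restr (corner_incl k j l) c)) /\ y = restr g c
  end.

Lemma corner_inj k (c c' : Y k.+1) : (n < k.+1)%N ->
  (forall j l, restr (corner_incl k j l) c = restr (corner_incl k j l) c') -> c = c'.
Proof.
move=> nk cc'; have /bij_inj inj := Ystep nk.
have yE : yoneda c = yoneda c' by apply: inj; exact: cubeset_map_ext.
have /= := congr1 (fun s : cubeset_map (box k.+1) Y => s k.+1 (box_id _)) yE.
by rewrite !restr_id.
Qed.

Lemma corner_fill k (b : forall j, corner k j -> Y j) : (n < k.+1)%N ->
  (forall i j (h : box_hom i j) l, b i (restr h l) = restr h (b j l)) ->
  exists c : Y k.+1, forall j l, restr (corner_incl k j l) c = b j l.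
Proof.
move=> nk bN; have [g _ gK] := Ystep nk.
exists (g (CubesetMap bN) _ (box_id _)) => j l.
have := congr1 (fun s : cubeset_map (corner k) Y => s j l) (gK (CubesetMap bN)).
by rewrite /= -app_restr /= box_comp1f => ->.
Qed.

Lemma teval_uniq m (t : term m) y y' : teval t y -> teval t y' -> y = y'.
Proof.
elim: t y y' => {m} [m x|k m nk b IH g] y y' /= => [-> ->//|].
move=> [c [cb ->]] [c' [cb' ->]]; congr restr; apply: corner_inj nk _ => j l.
exact: IH (cb _ _) (cb' _ _).
Qed.

Lemma teval_res l m (h : box_hom l m) (t : term m) y :
  teval t y -> teval (tres h t) (restr h y).
Proof.
case: t h y => {m} [m x|k m nk b g] h y /= => [->|[c [cb ->]]].
  by rewrite app_restr.
by exists c; rewrite restr_comp.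
Qed.

Lemma teq_eval m (s t : term m) : teq s t -> exists y, teval s y /\ teval t y.
Proof.
have fill k (b b' : forall j, corner k j -> term j) : (n < k.+1)%N ->
    (forall j l, exists y, teval (b j l) y /\ teval (b' j l) y) ->
    (forall i j (h : box_hom i j) l, exists y,
       teval (tres h (b j l)) y /\ teval (b' i (restr h l)) y) ->
    exists c : Y k.+1, forall j l, teval (b j l) (restr (corner_incl k j l) c) /\
      teval (b' j l) (restr (corner_incl k j l) c).
  move=> nk bb' bN.
  pose v j l := sval (cid (bb' j l)).
  have vP j l : teval (b j l) (v j l) /\ teval (b' j l) (v j l).
    by rewrite /v; case: cid.
  have [|c cE] := @corner_fill k v nk.
    move=> i j h l; have [y [yb yb']] := bN i j h l.
    rewrite (teval_uniq (vP _ _).2 yb'); apply: teval_uniq yb _.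
    exact/teval_res/(vP _ _).1.
  by exists c => j l; rewrite cE.
move=> st; elim: st => {m s t}.
- by move=> m s t _ [y [? ?]]; exists y.
- move=> m s t u _ [y [ys yt]] _ [y' [yt' yu]]; exists y; split=> //.
  by rewrite (teval_uniq yt yt').
- by move=> m x; exists (f m x).
- move=> k m nk b b' g _ bb' _ bN; have [c cP] := fill _ _ _ nk bb' bN.
  by exists (restr g c); split; exists c; split=> // j l; case: (cP j l).
- move=> k m nk b l _ bb _ bN; have [c cP] := fill _ _ _ nk bb bN.
  exists (restr (corner_incl k m l) c); split; last by case: (cP m l).
  by exists c; split=> // j l'; case: (cP j l').
- move=> k m nk b g t _ [y [yt _]] _ tb; exists (restr g y); split; last exact: teval_res.
  exists y; split=> // j l; have [z [zt zb]] := tb j l.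
  by rewrite -(teval_uniq zt (teval_res _ yt)).
Qed.

Lemma trunc_lift_ex : exists g : cubeset_map trunc Y, compmap g trunc_unit = f.
Proof.
pose ev m (c : tcells m) : Y m := sval (cid (teq_eval (trepP c))).
have evP m (c : tcells m) : teval (trep c) (ev m c).
  by rewrite /ev; case: cid => y [].
have evE m (c : tcells m) t y : teq (trep c) t -> teval t y -> ev m c = y.
  move=> /teq_eval[z [zc zt]] ty.
  by rewrite (teval_uniq ty zt); exact: teval_uniq (evP _ _) zc.
have evN l m (h : box_hom l m) (c : trunc m) : ev l (restr h c) = restr h (ev m c).
  by apply: evE (trep_class _) _; exact/teval_res/evP.
exists (@CubesetMap trunc Y ev evN); apply: cubeset_map_ext => m x /=.
exact: evE (trep_class _) _.
Qed.

(* Every term related to itself has self-related, natural boundaries. *)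
Fixpoint twf m (t : term m) : Prop :=
  match t with
  | tin _ _ => True
  | tfill k _ _ b _ => (forall j l, twf (b j l)) /\
      (forall j l, teq (b j l) (b j l)) /\
      (forall i j (h : box_hom i j) l, teq (tres h (b j l)) (b i (restr h l)))
  end.

Lemma teq_wf m (s t : term m) : teq s t -> twf s /\ twf t.
Proof.
have wres l m' (h : box_hom l m') u : twf u -> twf (tres h u).
  by case: u h.
elim=> {m s t} /=.
- by move=> m s t _ [].
- by move=> m s t u _ [? _] _ [].
- by [].
- move=> k m nk b b' g bb' wbb' bN _; do ![split] => //.
  + by move=> j l; case: (wbb' j l).
  + by move=> j l; exact: teq_refl_l (bb' j l).
  + by move=> i j h l; exact: teq_trans (bN _ _ h l) (teq_sym (bb' _ _)).
  + by move=> j l; case: (wbb' j l).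
  + by move=> j l; exact: teq_refl_r (bb' j l).
  + move=> i j h l; apply: teq_trans (bN _ _ h l).
    exact/teq_res/teq_sym/bb'.
- move=> k m nk b l bb wb bN _; split; last by case: (wb m l).
  by do ![split] => // j l'; case: (wb j l').
- move=> k m nk b g t tt [wt _] tb wb; split; last exact: wres.
  do ![split] => [j l|j l|]; first by case: (wb j l).
    exact: teq_refl_r (tb j l).
  exact: teq_bnd_nat tb.
Qed.

Lemma trunc_lift_eval (g : cubeset_map trunc Y) : compmap g trunc_unit = f ->
  forall m (t : term m) (tt : teq t t), teval t (g m (tclass tt)).
Proof.
move=> gf m t tt; have [wt _] := teq_wf tt.
elim: t tt wt => {m} [m x|k m nk b IH h] tt /= wt.
  by rewrite -gf /=; congr (g m _); exact/tclass_eq.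
case: wt => wb [bb bN].
have cc : teq (tfill nk b (box_id _)) (tfill nk b (box_id _)) by exact: teq_fill.
exists (g _ (tclass cc)); split=> [j l|].
  rewrite -app_restr [restr _ _]tcres_class.
  suff -> : tclass (teq_res (corner_incl k j l) cc) = tclass (bb j l) by exact: IH.
  by apply/tclass_eq; rewrite /= box_comp1f; exact: teq_beta.
rewrite -app_restr [restr _ _]tcres_class; congr (g m _); apply/tclass_eq.
by rewrite /= box_comp1f.
Qed.

End Universal.

Lemma trunc_adjoint (Y : cubeset) : n_step n Y ->
  bijective (fun g : cubeset_map trunc Y => compmap g trunc_unit).
Proof.
move=> Ystep; apply: bijP => [g g' gg'|f]; last exact: trunc_lift_ex.
apply: cubeset_map_ext => m c; rewrite -(trepK c).
apply: (teval_uniq Ystep (f := compmap g trunc_unit)); exact: trunc_lift_eval.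
Qed.

End Construction.

Lemma truncation_exists : inhabited (truncation n).
Proof.
have lift_ex X Y (f : cubeset_map X Y) :
    exists g, compmap g (trunc_unit X) = compmap (trunc_unit Y) f.
  have [h _ hK] := trunc_adjoint X (trunc_n_step Y).
  by exists (h (compmap (trunc_unit Y) f)); exact: hK.
pose tm X Y (f : cubeset_map X Y) := sval (cid (lift_ex X Y f)).
have tmE X Y (f : cubeset_map X Y) :
    compmap (tm X Y f) (trunc_unit X) = compmap (trunc_unit Y) f.
  by rewrite /tm; case: cid.
have inj X Y : injective (fun g : cubeset_map (trunc X) (trunc Y) =>
    compmap g (trunc_unit X)).
  exact: bij_inj (trunc_adjoint X (trunc_n_step Y)).
have pt (X Y : cubeset) (f g : cubeset_map X Y) : f = g -> forall m x, f m x = g m x.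
  by move=> ->.
refine (inhabits (@Truncation n trunc trunc_n_step tm _ _ trunc_unit _ _)).
- by move=> X; apply: inj; rewrite tmE; exact: cubeset_map_ext.
- move=> X Y Z g f; apply: inj; rewrite /= tmE; apply: cubeset_map_ext => m x.
  have /= fx := pt _ _ _ _ (tmE _ _ f) m x.
  by rewrite /= fx; have /= -> := pt _ _ _ _ (tmE _ _ g) m (f m x).
- by move=> X Y f; rewrite tmE.
- by move=> X Y; exact: trunc_adjoint.
Qed.

End Existence.

(* Main.v *)
From mathcomp Require Import all_boot all_algebra.
From mathcomp Require Import boolp.
Require Import Defs.

Set Implicit Arguments.
Unset Strict Implicit.
Unset Printing Implicit Defensive.

Import GRing.Theory.

(** An m-cube of a concrete cubeset is a function on the 2^m vertices, so the
whole argument is about which functions on vertices are cubes. Write v <= w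
for the coordinatewise order on vertices; the face below w is the image of the
morphism v |-> v /\ w.

Filling corners allows a function to be extended vertex by vertex: if it is
defined on a down-closed set of vertices and is a cube on the face below each
of them, it can be extended to a minimal missing vertex w by filling the
corner of the face below w ([extension], in a form relative to a fibration).
Applied to two cubes with a common face, this yields a cube of one dimension
more in which their concatenation sits as an antidiagonal, so concatenations
are cubes ([glue]).

Concatenating with reflected or degenerate copies shows that whether the value
of a cube c at the top vertex can be changed to y depends only on y and on
c(1...1), not on the rest of c ([change_top_cst]). Hence any vertex of a cube
of dimension at most n+1 can be replaced by an equivalent one ([cube_sim]),
which makes ~_n an equivalence relation and says that the quotient map reflects
cubes of dimension at most n+1. In dimension greater than n the top vertex of
a cube is determined modulo ~_n by the others ([sim_top]). The two facts
together give liftings of corners against the quotient map, by choosing any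
representative of the top vertex in dimension at most n+1 and by filling in X
in higher dimension ([quotient_map_fibration]). Corners in the quotient can
then be lifted to X vertex by vertex and filled there, so that the quotient is
fibrant and n-step.

It remains to see that a map f from X to any n-step cubeset Y factors through
the quotient; Y need not be concrete. Changing one vertex of a cube c of
dimension at most n+1 can be realised as restriction to a common face of two
(n+1)-cubes with the same corner ([change_vertex]); f sends these to the same
cube, so f does not see the change. Higher cubes of Y are determined by their
corners, and induction applies ([n_step_map_sim]). The quotient therefore has
the universal property of the truncation, and all properties are transported
along the resulting isomorphism. *)

(** * Cube morphisms given by coordinates *)

(** Every map of cubes considered below sends a vertex to one whose coordinates
are each a constant, an input coordinate, or the negation of one: [(None, b)]
stands for the constant b and [(Some j, b)] for the j-th coordinate, negated if
b holds. *)
Definition coord_map m n (h : 'I_n -> option 'I_m * bool) (v : vert m) :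
    vert n :=
  [ffun i => (if (h i).1 is Some j then v j else false) (+) (h i).2].

Lemma coord_map_affine m n (h : 'I_n -> option 'I_m * bool) :
  is_affine (coord_map h).
Proof.
exists (\matrix_(j, i) (if (h i).1 == Some j then (-1) ^+ (h i).2 else 0))%R,
  (\row_i ((h i).2)%:R)%R => v.
apply/rowP => i; rewrite !mxE ffunE.
case hi: (h i) => [[j|] b] /=; last first.
  by rewrite big1 ?add0r // => j _; rewrite !mxE hi /= mulr0.
rewrite (bigD1 j) //= big1 => [|l lj]; rewrite !mxE hi /=.
  by rewrite eqxx addr0; case: (v j); case: b {hi}.
by rewrite (inj_eq Some_inj) eq_sym (negbTE lj) mulr0.
Qed.

Definition coord_hom m n (h : 'I_n -> option 'I_m * bool) : box_hom m n :=
  BoxHom (coord_map_affine h).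

Definition meet_hom m (u : vert m) : box_hom m m :=
  coord_hom (fun i => (if u i then Some i else None, false)).

Lemma meetE m (u v : vert m) i : meet_hom u v i = v i && u i.
Proof. by rewrite ffunE addbF /=; case: (u i); rewrite ?andbT ?andbF. Qed.

Lemma topE n i : top_vertex n i = true.
Proof. by rewrite ffunE. Qed.

Lemma meet_id m (v : vert m) : meet_hom v v = v.
Proof. by apply/ffunP => i; rewrite meetE andbb. Qed.

Lemma not_top n (v : vert n) : v != top_vertex n -> exists i, v i = false.
Proof.
move=> vt; apply: contrapT => vn; case/eqP: vt; apply/ffunP => i.
by rewrite topE; case E: (v i) => //; case: vn; exists i.
Qed.

Definition del_hom n (i : 'I_n.+1) : box_hom n.+1 n :=
  coord_hom (fun j => (Some (lift i j), false)).

Lemma face_del n (i : 'I_n.+1) (v : vert n.+1) :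
  v i = false -> face i (del_hom i v) = v.
Proof.
move=> vi; apply/ffunP => j; rewrite ffunE.
by case: unliftP => [k ->|->//]; rewrite ffunE addbF.
Qed.

(** Membership in the corner is visible on vertices: some coordinate is
constantly 0. *)
Lemma in_cornerP n m (g : box_hom m n.+1) :
  in_corner g <-> exists i, forall v, g v i = false.
Proof.
split=> [[i [h ->]]|[i gi]]; first by exists i => v /=; rewrite ffunE unlift_none.
exists i, (box_comp (del_hom i) g); apply: box_hom_ext => v.
by rewrite -[LHS](face_del (gi v)).
Qed.

Lemma corner_not_top n m (g : corner n m) v : sval g v != top_vertex n.+1.
Proof.
have [i gi] := (in_cornerP _).1 (svalP g).
by apply/eqP => /ffunP/(_ i); rewrite gi topE.
Qed.

Lemma in_corner_meet n m (u : vert n.+1) (g : box_hom m n.+1) :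
  u != top_vertex n.+1 -> in_corner (box_comp (meet_hom u) g).
Proof.
move=> /not_top[i ui]; apply/in_cornerP; exists i => v.
by rewrite [box_fun _ _]/= -[coord_map _ _]/(meet_hom _ _) meetE ui andbF.
Qed.

Lemma in_corner_vertex n (v : vert n.+1) :
  v != top_vertex n.+1 -> in_corner (box_vertex v).
Proof. by move=> /not_top[i vi]; apply/in_cornerP; exists i. Qed.

(** The symmetry of the cube that exchanges v and the top vertex; it reduces
statements about an arbitrary vertex to the top one. *)
Definition reflect_hom m (v : vert m) : box_hom m m :=
  coord_hom (fun i => (Some i, ~~ v i)).

Lemma reflectK m (v u : vert m) : reflect_hom v (reflect_hom v u) = u.
Proof. by apply/ffunP => i; rewrite ffunE /= ffunE /=; case: (u i); case: (v i). Qed.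

Lemma reflect_top m (v : vert m) : reflect_hom v (top_vertex m) = v.
Proof. by apply/ffunP => i; rewrite ffunE /= topE; case: (v i). Qed.

Section Padding.
Variables (m k : nat) (mk : m <= k).

Definition proj_hom : box_hom k m :=
  coord_hom (fun i => (Some (widen_ord mk i), false)).

(** The inclusion of the m-cube as the face through the top vertex on which
the last k - m coordinates are 1. *)
Definition pad_hom : box_hom m k := coord_hom (fun j : 'I_k =>
  if insub (val j) is Some i then (Some i, false) else (None, true)).

Lemma padK u : proj_hom (pad_hom u) = u.
Proof. by apply/ffunP => i; rewrite ffunE /= ffunE /= valK !addbF. Qed.

Lemma pad_top : pad_hom (top_vertex m) = top_vertex k.
Proof.
by apply/ffunP => j; rewrite topE ffunE /=; case: insubP => //= i _ _; rewrite topE.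
Qed.

Lemma pad_eq_top u : (pad_hom u == top_vertex k) = (u == top_vertex m).
Proof.
apply/eqP/eqP => [ut|->]; last exact: pad_top.
by apply/ffunP => i; rewrite -(padK u) ut ffunE /= !topE.
Qed.

End Padding.

(** * Cubes as families of vertices *)

Definition cube (X : cubeset) m (f : vert m -> X 0) : Prop :=
  exists x : X m, f = vertices x.

Lemma vertices_restr (X : cubeset) l m (g : box_hom l m) (x : X m) :
  vertices (restr g x) = vertices x \o g.
Proof.
apply: funext => v /=; rewrite /vertices -restr_comp; congr restr.
exact: box_hom_ext.
Qed.

Lemma vertices_app X Y (p : cubeset_map X Y) m (x : X m) :
  vertices (p m x) = p 0 \o vertices x.
Proof. by apply: funext => v; rewrite /vertices /= app_restr. Qed.

Lemma vert0 (v w : vert 0) : v = w.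
Proof. by apply/ffunP => -[]. Qed.

Lemma vertices0 (X : cubeset) (x : X 0) v : vertices x v = x.
Proof.
by rewrite -[RHS]restr_id; congr restr; apply: box_hom_ext => w; exact: vert0.
Qed.

Lemma cube_vertices (X : cubeset) m (x : X m) : cube (vertices x).
Proof. by exists x. Qed.

Lemma cube_comp (X : cubeset) l m (g : box_hom l m) (f : vert m -> X 0) :
  cube f -> cube (f \o g).
Proof. by move=> [x ->]; exists (restr g x); rewrite vertices_restr. Qed.

Lemma cube_app X Y (p : cubeset_map X Y) m (f : vert m -> X 0) :
  cube f -> cube (p 0 \o f).
Proof. by move=> [x ->]; exists (p m x); rewrite vertices_app. Qed.

Lemma cube0 (X : cubeset) (f : vert 0 -> X 0) : cube f.
Proof.
exists (f (top_vertex 0)); apply: funext => v.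
by rewrite vertices0; congr f; exact: vert0.
Qed.

Definition upd m V (f : vert m -> V) (w : vert m) (y : V) : vert m -> V :=
  fun v => if v == w then y else f v.

Lemma upd_id m V (f : vert m -> V) w : upd f w (f w) = f.
Proof. by apply: funext => v; rewrite /upd; case: eqP => // ->. Qed.

(** A property stable under changing a single value along R passes to any
function related pointwise by R, since there are finitely many vertices. *)
Lemma pointwise_ind m V (R : V -> V -> Prop) (P : (vert m -> V) -> Prop) :
  (forall g v y, P g -> R (g v) y -> P (upd g v y)) ->
  forall g g' : vert m -> V, P g -> (forall v, R (g v) (g' v)) -> P g'.
Proof.
move=> step g g' Pg gg'.
pose gs (s : seq (vert m)) v := if v \in s then g' v else g v.
have H s : uniq s -> P (gs s).
  elim: s => [//|w s IH] /= /andP[ws /IH Ps].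
  have -> : gs (w :: s) = upd (gs s) w (g' w).
    by apply: funext => v; rewrite /gs /upd inE; case: eqP => [->|].
  by apply: step => //; rewrite /gs (negbTE ws).
have -> : g' = gs (enum {: vert m}) by apply: funext => v; rewrite /gs mem_enum.
exact/H/enum_uniq.
Qed.

Lemma concrete_map_ext A (Y : cubeset) (f g : cubeset_map A Y) : concrete Y ->
  (forall m (x : A m) v, vertices (f m x) v = vertices (g m x) v) -> f = g.
Proof.
by move=> Yc fg; apply: cubeset_map_ext => m x; apply: Yc; exact: funext.
Qed.

(** * Fibrations of concrete cubesets *)

(** The right lifting property against the corner of the k-cube, on vertices:
a function f that is a cube on every proper face through the origin, lying over
the cube b away from the top vertex, has a value at the top vertex that
completes it to a cube over b. For k = 0, if X(0) is nonempty,
it says that p is onto in dimension 0. *)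
Definition fills_top X Z (p : cubeset_map X Z) k : Prop :=
  forall (f : vert k -> X 0) (b : vert k -> Z 0),
    cube b ->
    (forall v, v != top_vertex k -> p 0 (f v) = b v) ->
    (forall u, u != top_vertex k -> cube (f \o meet_hom u)) ->
    exists y, p 0 y = b (top_vertex k) /\ cube (upd f (top_vertex k) y).

(** A map out of the corner is given by its values on vertices; conversely, in
a concrete cubeset, a function on vertices that is a cube on proper faces is a
map out of the corner. *)
Lemma corner_vertices (X : cubeset) k (a : cubeset_map (corner k) X) :
  exists f : vert k.+1 -> X 0,
    forall m (g : corner k m) v, vertices (a m g) v = f (sval g v).
Proof.
have /choice[f fP] : forall v : vert k.+1, exists w,
    forall m (g : corner k m) x, sval g x = v -> vertices (a m g) x = w.
  move=> v; have [vt|vt] := eqVneq v (top_vertex k.+1).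
    have t0 : [ffun => false] != top_vertex k.+1.
      by apply/eqP => /ffunP/(_ ord0); rewrite !ffunE.
    (* The top vertex is not in the corner, so its value is arbitrary. *)
    exists (a 0 (exist _ _ (in_corner_vertex t0))) => m g x gx.
    by have := corner_not_top g x; rewrite gx vt eqxx.
  exists (a 0 (exist _ _ (in_corner_vertex vt))) => m g x gx.
  rewrite /vertices -app_restr; congr (a 0 _); apply: corner_ext.
  by apply: box_hom_ext => w /=; rewrite gx.
by exists f => m g v; exact: fP.
Qed.

Lemma corner_map_of_cubes (X : cubeset) k (f : vert k.+1 -> X 0) : concrete X ->
  (forall u, u != top_vertex k.+1 -> cube (f \o meet_hom u)) ->
  exists a : cubeset_map (corner k) X,
    forall m (g : corner k m) v, vertices (a m g) v = f (sval g v).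
Proof.
move=> Xc fc.
have ex m (g : corner k m) : exists x : X m, vertices x = f \o sval g.
  have [i gi] := (in_cornerP _).1 (svalP g).
  pose u : vert k.+1 := [ffun j => j != i].
  have ut : u != top_vertex k.+1.
    by apply/eqP => /ffunP/(_ i); rewrite !ffunE eqxx.
  have [x xE] := cube_comp (sval g) (fc u ut).
  exists x; rewrite -xE; apply: funext => v; congr f.
  apply/ffunP => j; rewrite meetE ffunE.
  by have [->|_] := eqVneq j i; rewrite ?gi ?andbT.
pose a m g := sval (cid (ex m g)).
have aP m g : vertices (a m g) = f \o sval g by rewrite /a; case: cid.
have aN l m (h : box_hom l m) (g : corner k m) :
    a l (restr h g) = restr h (a m g).
  by apply: Xc; rewrite vertices_restr !aP.
by exists (CubesetMap aN) => m g v /=; rewrite aP.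
Qed.

Lemma fibration_fills X Z (p : cubeset_map X Z) : concrete X -> concrete Z ->
  fibration p <-> forall k, fills_top p k.+1.
Proof.
move=> Xc Zc; split=> [pF k f b [c ->] fb fc|pF k a b ab].
  have [a aE] := corner_map_of_cubes Xc fc.
  have sq : compmap p a = compmap (yoneda c) (corner_incl k).
    apply: concrete_map_ext => // m g v.
    rewrite /= vertices_app vertices_restr /= aE fb //.
    exact: corner_not_top.
  have [l [la pl]] := pF k a (yoneda c) sq.
  pose x := l _ (box_id k.+1).
  exists (vertices x (top_vertex k.+1)); split.
    rewrite -[LHS]/((p 0 \o vertices x) _) -vertices_app.
    by rewrite -[p _ x]/(compmap p l _ _) pl /= restr_id.
  exists x; apply: funext => v; rewrite /upd; case: eqP => [->//|/eqP vt].
  rewrite /vertices /x -app_restr /= box_comp1f.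
  pose g : corner k 0 := exist _ _ (in_corner_vertex vt).
  rewrite -[l 0 _]/(compmap l (corner_incl k) 0 g) la.
  by rewrite -(vertices0 (a 0 g) (top_vertex 0)) aE.
have [f fE] := corner_vertices a.
have abE m (g : corner k m) : p m (a m g) = b m (sval g).
  by rewrite -[LHS]/(compmap p a m g) ab.
have [||u ut|y [yb [x xE]]] := pF k f (vertices (b _ (box_id k.+1))).
- exact: cube_vertices.
- move=> v vt; pose g : corner k 0 := exist _ _ (in_corner_vertex vt).
  have <- : vertices (a 0 g) (top_vertex 0) = f v by rewrite fE.
  rewrite vertices0 abE /=.
  by rewrite /vertices -app_restr /= box_comp1f.
- pose g : corner k k.+1 := exist _ _ (in_corner_meet (box_id _) ut).
  by exists (a _ g); apply: funext => v; rewrite fE.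
exists (yoneda x); split.
  apply: concrete_map_ext => // m g v.
  rewrite /= vertices_restr /= -xE fE /upd.
  by rewrite (negbTE (corner_not_top g v)).
rewrite (box_map_yoneda b); apply: concrete_map_ext => // m g v /=.
rewrite app_restr; congr (vertices (restr g _) v).
apply: Zc; apply: funext => w; rewrite vertices_app /= -xE /upd.
case: eqP => [->//|/eqP wt].
pose h : corner k 0 := exist _ _ (in_corner_vertex wt).
have <- : vertices (a 0 h) (top_vertex 0) = f w by rewrite fE.
by rewrite vertices0 abE /= /vertices -app_restr /= box_comp1f.
Qed.

Lemma map_to_point_unique A (f g : cubeset_map A point) : f = g.
Proof. by apply: cubeset_map_ext => n x; case: (f n x); case: (g n x). Qed.

Lemma concrete_point : concrete point.
Proof. by move=> n [] []. Qed.

Lemma fibrant_fills (X : cubeset) : concrete X ->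
  fibrant X <-> forall k, fills_top (to_point X) k.
Proof.
move=> Xc; rewrite /fibrant (fibration_fills (to_point X) Xc concrete_point).
split=> [XF [|k]|XF k]; [|exact: XF|exact: XF].
move=> f b _ _ _; exists (f (top_vertex 0)); split; first by case: (b _).
exact: cube0.
Qed.

(** * Extension from down-closed sets of vertices *)

(** The face below w has dimension the number of coordinates i with w i, and
[fincl w] parametrises it; [fproj w] forgets the other coordinates. *)
Section FaceParametrisation.
Variables (m : nat) (w : vert m).

Definition fdim := #|[pred i | w i]|.

Definition fincl : box_hom fdim m :=
  coord_hom (fun i => ([pick j : 'I_fdim | enum_val j == i], false)).

Definition fproj : box_hom m fdim :=
  coord_hom (fun j => (Some (enum_val j), false)).

Lemma fprojE v j : fproj v j = v (enum_val j).
Proof. by rewrite ffunE addbF. Qed.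

Lemma fincl_val t j : fincl t (enum_val j) = t j.
Proof.
rewrite ffunE addbF /=; case: pickP => [l /eqP/enum_val_inj ->//|/(_ j)].
by rewrite eqxx.
Qed.

Lemma fincl_out t i : w i = false -> fincl t i = false.
Proof.
rewrite ffunE addbF /= => wi; case: pickP => // j /eqP ji.
by have := enum_valP j; rewrite ji inE wi.
Qed.

Lemma finclP (P : 'I_m -> Prop) :
  (forall i, w i = false -> P i) ->
  (forall j : 'I_fdim, P (enum_val j)) -> forall i, P i.
Proof.
move=> P0 P1 i; case wi: (w i); last exact: P0.
have iw : i \in [pred i | w i] by [].
by rewrite -(enum_rankK_in iw iw); exact: P1.
Qed.

Lemma fval_in (j : 'I_fdim) : w (enum_val j).
Proof. by have := enum_valP j; rewrite inE. Qed.

Lemma finclK t : fproj (fincl t) = t.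
Proof. by apply/ffunP => j; rewrite fprojE fincl_val. Qed.

Lemma fprojK v : fincl (fproj v) = meet_hom w v.
Proof.
apply/ffunP; apply: finclP => [i wi|j]; rewrite meetE.
  by rewrite fincl_out // wi andbF.
by rewrite fincl_val fprojE fval_in andbT.
Qed.

Lemma meet_fincl t : meet_hom w (fincl t) = fincl t.
Proof. by rewrite -fprojK finclK. Qed.

Lemma fproj_top : fproj w = top_vertex fdim.
Proof. by apply/ffunP => j; rewrite fprojE topE fval_in. Qed.

Lemma fincl_top : fincl (top_vertex fdim) = w.
Proof. by rewrite -fproj_top fprojK meet_id. Qed.

Lemma fincl_meet t s : fincl (meet_hom t s) = meet_hom (fincl t) (fincl s).
Proof.
apply/ffunP; apply: finclP => [i wi|j]; rewrite meetE.
  by rewrite !fincl_out.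
by rewrite !fincl_val meetE.
Qed.

Lemma fproj_eq_top v : (fproj v == top_vertex fdim) = (meet_hom w v == w).
Proof.
apply/eqP/eqP => [vt|vw]; first by rewrite -fprojK vt fincl_top.
by rewrite -(finclK (fproj v)) fprojK vw fproj_top.
Qed.

End FaceParametrisation.

Section Extension.
Variables (X Z : cubeset) (p : cubeset_map X Z).
Hypothesis pF : forall k, fills_top p k.

(** Corner filling in the face below w, phrased in the ambient cube. *)
Lemma fills_face m (w : vert m) (f : vert m -> X 0) (b : vert m -> Z 0) :
  cube (b \o meet_hom w) ->
  (forall u, meet_hom w u = u -> u != w ->
     p 0 (f u) = b u /\ cube (f \o meet_hom u)) ->
  exists y, p 0 y = b w /\ cube (upd f w y \o meet_hom w).
Proof.
move=> bc fH.
have lt_w t : t != top_vertex (fdim w) -> fincl w t != w.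
  by apply: contraNneq => tw; rewrite -(finclK t) tw fproj_top.
have [|t tt|t tt|y [yb yc]] := pF (f := f \o fincl w) (b := b \o fincl w).
- have := cube_comp (fincl w) bc; congr cube; apply: funext => t /=.
  by congr b; exact: meet_fincl.
- by case: (fH _ (meet_fincl t) (lt_w t tt)).
- case: (fH _ (meet_fincl t) (lt_w t tt)) => _ /(cube_comp (fincl w)).
  congr cube; apply: funext => s; congr f.
  exact/esym/fincl_meet.
exists y; split; first by rewrite yb /=; congr b; exact: fincl_top.
have := cube_comp (fproj w) yc; congr cube; apply: funext => v.
rewrite /comp /upd fproj_eq_top; case: ifP => // _.
by congr f; exact: fprojK.
Qed.

Definition down_closed m (S : {set vert m}) :=
  forall u v, u \in S -> meet_hom u v \in S.

(** Take a minimal vertex w of T outside S. Everything strictly below w is in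
S, so the face below w carries a filled-in corner and w can be added to S. *)
Lemma extension m (b : vert m -> Z 0) (T S : {set vert m}) (f : vert m -> X 0) :
  down_closed T -> down_closed S -> S \subset T ->
  (forall u, u \in T -> cube (b \o meet_hom u)) ->
  (forall u, u \in S -> p 0 (f u) = b u /\ cube (f \o meet_hom u)) ->
  exists g : vert m -> X 0, (forall u, u \in S -> g u = f u) /\
    forall u, u \in T -> p 0 (g u) = b u /\ cube (g \o meet_hom u).
Proof.
move=> Td Sd ST bc; move Ek: #|T :\: S| => k.
elim: k S Sd ST Ek f => [|k IH] S Sd ST Ek f fH.
  exists f; split=> // u uT; apply: fH; apply: contraT => uS.
  by have := cards0_eq Ek => /setP/(_ u); rewrite !inE uS uT.
have [w0 w0TS] : exists w, w \in T :\: S by apply/card_gt0P; rewrite Ek.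
(* A vertex with the fewest coordinates equal to 1 is minimal. *)
pose ht (w : vert m) := #|[pred i | w i]|.
case: (@arg_minnP _ w0 (fun w => w \in T :\: S) ht w0TS) => w.
rewrite inE => /andP[wS wT] wmin.
have below u : meet_hom w u = u -> u != w -> u \in S.
  move=> uw nuw; apply: contraT => uS.
  have uT : u \in T by rewrite -uw; exact: Td.
  have sub : [pred i | u i] \subset [pred i | w i].
    by apply/subsetP => i; rewrite !inE -{1}uw meetE => /andP[].
  have : ht w <= ht u by apply: wmin; rewrite inE uS uT.
  rewrite leqNgt => /negP[]; apply: proper_card; rewrite properE sub /=.
  apply: contra nuw => /subsetP ws; apply/eqP/ffunP => i.
  by rewrite -{1}uw meetE; case wi: (w i); rewrite ?andbF // andbT; exact: ws.
have [u uw nuw|y [yb yc]] := fills_face (f := f) (bc w wT).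
  exact/fH/below.
have Sw u : u \in S -> u == w = false.
  by move=> uS; apply: contraNF wS => /eqP <-.
have [|||u|g [gS gT]] := IH (w |: S) _ _ _ (upd f w y).
- move=> u v; rewrite !inE => /orP[/eqP ->|uS]; last by rewrite Sd ?orbT.
  have [//|nw] := eqVneq (meet_hom w v) w; apply: below => //.
  by apply/ffunP => i; rewrite !meetE -andbA andbb.
- by rewrite subUset sub1set wT.
- rewrite (setUC [set w]) -setDDl; apply/eqP; rewrite -eqSS -Ek.
  by rewrite (cardsD1 w (T :\: S)) inE wS wT.
- rewrite !inE => /orP[/eqP ->|uS]; first by rewrite {1}/upd eqxx.
  rewrite /upd Sw //; have [fu uc] := fH u uS; split=> //.
  move: uc; congr cube; apply: funext => v.
  by rewrite /comp Sw //; exact: Sd.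
exists g; split=> // u uS; rewrite gS ?inE ?uS ?orbT //.
by rewrite /upd Sw.
Qed.

End Extension.

(** * Gluing and changing a vertex *)

Section ConcreteFibrant.
Variables (X : cubeset) (Xc : concrete X) (Xf : fibrant X).

Let fill k := (fibrant_fills Xc).1 Xf k.

Definition setc N (i : 'I_N) (e : bool) : box_hom N N :=
  coord_hom (fun j => if j == i then (None, e) else (Some j, false)).

Lemma setcE N (i : 'I_N) e v j : setc i e v j = if j == i then e else v j.
Proof. by rewrite ffunE; case: eqP => //= _; rewrite addbF. Qed.

Lemma setc_id N (i : 'I_N) e (v : vert N) : v i = e -> setc i e v = v.
Proof. by move=> vi; apply/ffunP => j; rewrite setcE; case: eqP => // ->. Qed.

Lemma setc_eq_top N (i : 'I_N) v :  setc i false v != top_vertex N.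
Proof. by apply/eqP => /ffunP/(_ i); rewrite setcE eqxx topE. Qed.

(** Concatenation in direction i. Regarding c and d as paths p0 -> p1 and
p1 -> p2 in direction i, place p1, p0, p2 at the corners (0,0), (1,0), (0,1) of
a square, fill the last corner, and read off the antidiagonal from (1,0) to
(0,1). The antidiagonal t |-> (1 - t, t) is affine, so its restriction is a
cube. *)
Lemma glue N (i : 'I_N) (c d : vert N -> X 0) : cube c -> cube d ->
  (forall v, c (setc i true v) = d (setc i false v)) ->
  cube (fun v => if v i then d v else c v).
Proof.
move=> cc dc cd.
(* The new coordinate 0 is the first side of the square, and coordinate i of the
   original cube is the second one. *)
pose tl := del_hom (ord0 : 'I_N.+1).
pose tw : box_hom N.+1 N := coord_hom
  (fun j => if j == i then (Some ord0, true) else (Some (lift ord0 j), false)).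
have twE s j : tw s j = if j == i then ~~ s ord0 else s (lift ord0 j).
  by rewrite ffunE; case: eqP => _; rewrite ?addbT ?addbF.
have tlE s j : tl s j = s (lift ord0 j) by rewrite ffunE addbF.
pose F (s : vert N.+1) := if s ord0 then c (tw s) else d (tl s).
pose S := [set s : vert N.+1 | ~~ (s ord0 && s (lift ord0 i))].
have F0 (s : vert N.+1) : s (lift ord0 i) = false -> F s = c (tw s).
  rewrite /F => si; case: ifP => // s0.
  have -> : tw s = setc i true (tl s).
    by apply/ffunP => j; rewrite twE setcE s0 tlE.
  by rewrite cd setc_id // tlE.
have [|||||G [GS GT]] := extension (p := to_point X) fill
    (b := fun => tt) (T := setT) (S := S) (f := F).
- by move=> u v _; rewrite inE.
- move=> u v; rewrite !inE !meetE; apply: contra => /andP[/andP[_ ->]].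
  by move=> /andP[_ ->].
- exact: subsetT.
- by move=> u _; exists tt.
- move=> u; rewrite inE negb_and => uS; split=> //.
  case/orP: uS => /negbTE u0.
    have := cube_comp (box_comp tl (meet_hom u)) dc; congr cube.
    apply: funext => v /=.
    by rewrite /F -[coord_map _ v]/(meet_hom u v) meetE u0 andbF.
  have := cube_comp (box_comp tw (meet_hom u)) cc; congr cube.
  apply: funext => v; rewrite [LHS]/= [RHS]/= -[coord_map _ v]/(meet_hom u v).
  by rewrite F0 // meetE u0 andbF.
(* The antidiagonal v |-> (1 - v_i, v). *)
pose a : box_hom N N.+1 := coord_hom
  (fun j => if unlift ord0 j is Some k then (Some k, false) else (Some i, true)).
have a0 v : a v ord0 = ~~ v i by rewrite ffunE unlift_none /= addbT.
have aS v j : a v (lift ord0 j) = v j by rewrite ffunE liftK /= addbF.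
have [_ Gc] := GT (top_vertex _) (in_setT _).
have := cube_comp a Gc; congr cube; apply: funext => v.
rewrite -[LHS]/(G (meet_hom (top_vertex _) (a v))).
have -> : meet_hom (top_vertex _) (a v) = a v.
  by apply/ffunP => j; rewrite meetE topE andbT.
rewrite GS; last by rewrite inE a0 aS; case: (v i).
rewrite /F a0; case vi: (v i) => /=.
  by congr d; apply/ffunP => j; rewrite tlE aS.
congr c; apply/ffunP => j; rewrite twE a0 aS vi /=.
by case: eqP => // ->; rewrite vi.
Qed.

(** Let c' be c made constant in direction i with the values of its upper
face. The reflection of c followed by the changed c concatenates to the
changed c', and c followed by the changed c' to the changed c. *)
Lemma change_top_setc N (i : 'I_N) (c : vert N -> X 0) y : cube c ->
  cube (upd c (top_vertex N) y) <->
  cube (upd (c \o setc i true) (top_vertex N) y).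
Proof.
move=> cc; split=> H.
  pose fl : box_hom N N := coord_hom (fun j => (Some j, j == i)).
  have flE v j : fl v j = v j (+) (j == i) by rewrite ffunE.
  have := glue (i := i) (cube_comp fl cc) H.
  have fl1 v : fl (setc i true v) = setc i false v.
    apply/ffunP => j; rewrite flE !setcE.
    by case: eqP => //= _; rewrite addbF.
  have hyp v : (c \o fl) (setc i true v) = upd c (top_vertex N) y (setc i false v).
    by rewrite /upd (negbTE (setc_eq_top _ _)) /comp fl1.
  move=> /(_ hyp); congr cube; apply: funext => v; rewrite /upd /comp.
  case vi: (v i); first by rewrite setc_id.
  case: eqP => [vt|_]; first by move: vi; rewrite vt topE.
  congr c; apply/ffunP => j; rewrite flE setcE.
  by case: eqP => [->|_]; rewrite ?vi ?addbF.
have := glue (i := i) cc H.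
have hyp v : c (setc i true v) =
    upd (c \o setc i true) (top_vertex N) y (setc i false v).
  rewrite /upd (negbTE (setc_eq_top _ _)) /comp; congr c.
  by apply/ffunP => j; rewrite !setcE; case: eqP.
move=> /(_ hyp); congr cube; apply: funext => v; rewrite /upd /comp.
case vi: (v i); first by rewrite setc_id.
by case: eqP => // vt; move: vi; rewrite vt topE.
Qed.

(** Making c constant in all directions, one after the other. *)
Lemma change_top_cst N (c : vert N -> X 0) y : cube c ->
  cube (upd c (top_vertex N) y) <->
  cube (upd (fun => c (top_vertex N)) (top_vertex N) y).
Proof.
have H (s : seq 'I_N) : forall c : vert N -> X 0, cube c ->
    exists2 d : vert N -> X 0, cube d &
    (forall v, d v = c [ffun i => (i \in s) || v i]) /\
    (cube (upd c (top_vertex N) y) <-> cube (upd d (top_vertex N) y)).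
  elim: s => [|i s IH] {}c cc.
    by exists c => //; split=> // v; congr c; apply/ffunP => i; rewrite ffunE.
  have [d dc [dE dP]] := IH _ (cube_comp (setc i true) cc); exists d => //.
  split=> [v|]; last by rewrite (change_top_setc i).
  rewrite dE /=; congr c; apply/ffunP => j; rewrite setcE !ffunE inE.
  by case: eqP.
move=> /(H (enum 'I_N))[d _ [dE ->]].
suff -> : d = fun => c (top_vertex N) by [].
apply: funext => v; rewrite dE; congr c; apply/ffunP => i.
by rewrite !ffunE mem_enum.
Qed.

Variable n : nat.

(** The two cubes in the definition of ~_n share all vertices but the top. *)
Lemma simP (x y : X 0) : sim n x y <-> exists c : vert n.+1 -> X 0,
  [/\ cube c, c (top_vertex n.+1) = x & cube (upd c (top_vertex n.+1) y)].
Proof.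
split=> [[c [c' [cc' cx cy]]]|[c [[d ->] dx [d' d'E]]]].
  exists (vertices c); split=> //; first exact: cube_vertices.
  exists c'.
  apply: funext => v; rewrite /upd; have [->//|vt] := eqVneq v (top_vertex n.+1).
  pose g : corner n 0 := exist _ _ (in_corner_vertex vt).
  exact: (congr1 (fun s : cubeset_map _ _ => s 0 g) cc').
exists d, d'; split=> //; last by rewrite -d'E /upd eqxx.
apply: concrete_map_ext => // m g v.
rewrite /= !vertices_restr -d'E /comp /upd.
by rewrite (negbTE (corner_not_top g v)).
Qed.

(** By [change_top_cst] the cube that witnesses the equivalence can be
exchanged for any other one with the same top vertex. *)
Lemma change_top (c : vert n.+1 -> X 0) y : cube c ->
  sim n (c (top_vertex n.+1)) y -> cube (upd c (top_vertex n.+1) y).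
Proof.
move=> cc /simP[a [ac ax /(change_top_cst _ ac)]].
by rewrite ax => /(change_top_cst _ cc).
Qed.

Lemma cube_cst m (x : X 0) : cube (fun _ : vert m => x).
Proof.
exists (restr (coord_hom (fun i : 'I_0 => (None, false))) x).
by apply: funext => v; rewrite vertices_restr /= vertices0.
Qed.

Lemma sim_refl (x : X 0) : sim n x x.
Proof.
apply/simP; exists (fun => x); split=> //; first exact: cube_cst.
by rewrite (upd_id (fun => x)); exact: cube_cst.
Qed.

Lemma sim_sym (x y : X 0) : sim n x y -> sim n y x.
Proof. by move=> [c [c' [? ? ?]]]; exists c', c. Qed.

Lemma sim_trans (x y z : X 0) : sim n x y -> sim n y z -> sim n x z.
Proof.
move=> /simP[c [cc cx c'c]] yz; apply/simP; exists c; split=> //.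
have := change_top (y := z) c'c; rewrite {1}/upd eqxx => /(_ yz).
by congr cube; apply: funext => v; rewrite /upd; case: eqP.
Qed.

(** d is c made degenerate in n + 1 - m extra directions and reflected so that v
becomes the top vertex, d' is d with its top vertex changed to y, and h is a
face through the top vertex. The statement produces cells and not only vertex
functions because it is applied to maps into cubesets that are not concrete. *)
Lemma change_vertex m (c : X m) v y : m <= n.+1 -> sim n (vertices c v) y ->
  exists (d d' : X n.+1) (h : box_hom m n.+1),
    [/\ forall k (g : corner n k),
          restr (corner_incl n k g) d = restr (corner_incl n k g) d',
        restr h d = c & vertices (restr h d') = upd (vertices c) v y].
Proof.
move=> mn vy.
pose p := box_comp (reflect_hom v) (proj_hom mn).
pose h := box_comp (pad_hom m n.+1) (reflect_hom v).
have ph u : p (h u) = u.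
  by rewrite -[LHS]/(reflect_hom v (proj_hom mn (pad_hom m n.+1 _))) padK reflectK.
have ht u : (h u == top_vertex n.+1) = (u == v).
  rewrite -[h u]/(pad_hom m n.+1 (reflect_hom v u)) pad_eq_top //.
  by rewrite -{2}(reflect_top v) -(inj_eq (can_inj (reflectK v)) u) reflectK.
have hv : h v = top_vertex n.+1 by apply/eqP; rewrite ht.
have [||d' d'E] := @change_top (vertices (restr p c)) y.
- exact: cube_vertices.
- by rewrite vertices_restr /comp -hv ph.
exists (restr p c), d', h; split.
- move=> k g; apply: Xc; apply: funext => t.
  rewrite !vertices_restr -d'E vertices_restr /comp /upd.
  by rewrite (negbTE (corner_not_top g t)).
- rewrite -restr_comp -[RHS]restr_id; congr restr.
  by apply: box_hom_ext => u; exact: ph.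
rewrite vertices_restr -d'E; apply: funext => u; rewrite /comp /upd ht.
by rewrite vertices_restr /comp ph.
Qed.

Lemma cube_sim m (c c' : vert m -> X 0) : m <= n.+1 -> cube c ->
  (forall v, sim n (c v) (c' v)) -> cube c'.
Proof.
move=> mn; apply: pointwise_ind => _ v y [x ->].
by case/(change_vertex mn) => [d [d' [h [_ _ <-]]]]; exact: cube_vertices.
Qed.

(** Restrict both cubes to the (n+1)-dimensional face through the top vertex
given by padding. There the off-top values of c' can be replaced by those of c
by [cube_sim], and what remains is the definition of ~_n. *)
Lemma sim_top k (c c' : vert k -> X 0) : n < k -> cube c -> cube c' ->
  (forall v, v != top_vertex k -> sim n (c v) (c' v)) ->
  sim n (c (top_vertex k)) (c' (top_vertex k)).
Proof.
move=> nk cc c'c cc'.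
pose s := pad_hom n.+1 k.
have st : s (top_vertex n.+1) = top_vertex k by exact: pad_top.
apply/simP; exists (c \o s); split; first exact: cube_comp.
  by rewrite /comp st.
apply: cube_sim (leqnn _) (cube_comp s c'c) _ => t; rewrite /upd /comp.
case: eqP => [->|/eqP tt]; first by rewrite st; exact: sim_refl.
by apply/sim_sym/cc'; rewrite pad_eq_top.
Qed.

(** * The quotient *)

Local Notation Q := (quotient n X).
Local Notation q := (quotient_map n X).

Lemma sim_class_eq (x y : X 0) : sim_class n x = sim_class n y <-> sim n x y.
Proof.
split=> [[xy]|xy]; first by rewrite xy; exact: sim_refl.
apply: eq_sig_hprop => [? ? ?|/=]; first exact: Prop_irrelevance.
apply: funext => z; apply/propext; split; last exact: sim_trans.
exact/sim_trans/sim_sym.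
Qed.

Lemma quotient_map0_eq (x y : X 0) : q 0 x = q 0 y <-> sim n x y.
Proof.
rewrite -sim_class_eq; split=> [[/(congr1 (@^~ (top_vertex 0)))]|xy].
  by rewrite /quot_vertices !vertices0.
apply: quot_cells_ext; apply: funext => v.
by rewrite /= /quot_vertices !vertices0.
Qed.

Lemma quotient_map_surjective : surjective_map q.
Proof. by move=> m [c [x cE]]; exists x; apply: quot_cells_ext. Qed.

Lemma quotient_concrete : concrete Q.
Proof.
move=> m c d cd; apply: quot_cells_ext; apply: funext => v.
by have /(congr1 sval)/(congr1 (@^~ (top_vertex 0))) := congr1 (@^~ v) cd.
Qed.

Lemma quotient_cube_lift m (b : vert m -> Q 0) : cube b ->
  exists2 c : vert m -> X 0, cube c & b = q 0 \o c.
Proof.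
move=> [y ->]; have [x <-] := quotient_map_surjective y.
by exists (vertices x); [exact: cube_vertices|rewrite vertices_app].
Qed.

(** In dimension at most n+1 the top vertex of any lift of b works; above,
fill the corner in X, and [sim_top] shows that the result lies over b. *)
Lemma quotient_map_fills k : fills_top q k.
Proof.
move=> f b /quotient_cube_lift[c cc ->] fc fH.
have simfc v : v != top_vertex k -> sim n (c v) (f v).
  by move=> vt; apply/quotient_map0_eq; rewrite fc.
have [kn|nk] := leqP k n.+1.
  exists (c (top_vertex k)); split=> //; apply: cube_sim kn cc _ => v.
  rewrite /upd; case: eqP => [->|/eqP vt]; first exact: sim_refl.
  exact: simfc.
have [|||y [_ yc]] := fill (f := f) (b := fun => tt).
- by exists tt.
- by [].
- exact: fH.
exists y; split=> //; apply/quotient_map0_eq/sim_sym.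
have -> : y = upd f (top_vertex k) y (top_vertex k) by rewrite /upd eqxx.
apply: sim_top (ltnW nk) cc yc _ => v vt.
by rewrite /upd (negbTE vt); exact: simfc.
Qed.

Lemma quotient_map_fibration : fibration q.
Proof.
apply/(fibration_fills q Xc quotient_concrete) => k.
exact: quotient_map_fills.
Qed.

(** The corner is lifted to X with [extension] along the
quotient map, starting from the empty set of vertices, and filled in X. *)
Lemma quotient_fibrant : fibrant Q.
Proof.
apply/(fibrant_fills quotient_concrete) => k f b _ _ fH.
pose T := [set u | u != top_vertex k].
have Td : down_closed T.
  move=> u v; rewrite !inE => /not_top[i ui]; apply/eqP => /ffunP/(_ i).
  by rewrite meetE ui andbF topE.
(* The values x0 are placeholders, overwritten at every vertex of T. *)
have [x0 _] := quotient_map_surjective (f (top_vertex k)).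
have [u v||u|u|g [_ gT]] := extension quotient_map_fills (b := f) (S := set0)
    (f := fun => x0) Td.
- by rewrite inE.
- exact: sub0set.
- by rewrite inE; exact: fH.
- by rewrite inE.
have [|//|u ut|y [_ yc]] := fill (f := g) (b := fun _ : vert k => tt).
- by exists tt.
- by case: (gT u); rewrite ?inE.
exists (q 0 y); split; first by case: (b _).
have := cube_app q yc; congr cube; apply: funext => v; rewrite /comp /upd.
by case: eqP => // /eqP vt; case: (gT v) => //; rewrite inE.
Qed.

Lemma quotient_n_step : n_step n Q.
Proof.
move=> k nk; apply: bijP => [s s'|a]; last first.
  have [//|l [la _]] := quotient_fibrant (a := a) (b := to_point (box k.+1)).
    exact: map_to_point_unique.
  by exists l.
rewrite (box_map_yoneda s) (box_map_yoneda s').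
have [c <-] := quotient_map_surjective (s _ (box_id k.+1)).
have [c' <-] := quotient_map_surjective (s' _ (box_id k.+1)) => ss'.
congr yoneda; apply: quotient_concrete; rewrite !vertices_app.
have off v : v != top_vertex k.+1 -> sim n (vertices c v) (vertices c' v).
  move=> vt; apply/quotient_map0_eq.
  pose g : corner k 0 := exist _ _ (in_corner_vertex vt).
  rewrite -[LHS]/((q 0 \o vertices c) v) -[RHS]/((q 0 \o vertices c') v).
  rewrite -!vertices_app.
  exact: (congr1 (fun h : cubeset_map _ _ => h 0 g) ss').
apply: funext => v; apply/quotient_map0_eq.
have [->|vt] := eqVneq v (top_vertex k.+1); last exact: off.
exact: sim_top nk (cube_vertices _) (cube_vertices _) off.
Qed.

(** * Maps to n-step cubesets *)

Section MapsToNStep.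
Variables (Y : cubeset) (Ystep : n_step n Y) (f : cubeset_map X Y).

(** The (n+1)-cubes provided by [change_vertex] agree on the corner, so f
identifies them, and hence also their restrictions to h. *)
Lemma n_step_map_sim_low m (x x' : X m) : m <= n.+1 ->
  (forall v, sim n (vertices x v) (vertices x' v)) -> f m x = f m x'.
Proof.
move=> mn xx'.
pose P g := exists x0 : X m, vertices x0 = g /\ f m x0 = f m x.
suff [x0 [/Xc <- ->//]] : P (vertices x').
apply: pointwise_ind xx'; last by exists x.
move=> _ v y [x0 [<- fx0]] /(change_vertex mn)[d [d' [h [dd' dx0 <-]]]].
exists (restr h d'); split=> //; rewrite -fx0 -dx0 !app_restr; congr restr.
apply: (corner_inj Ystep) (ltnSn n) _ => k g.
by rewrite -!app_restr dd'.
Qed.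

(** In dimension greater than n+1, cubes of Y are determined by the faces in
the corner. *)
Lemma n_step_map_sim m (x x' : X m) :
  (forall v, sim n (vertices x v) (vertices x' v)) -> f m x = f m x'.
Proof.
elim: m x x' => [|m IH] x x' xx'; first exact: n_step_map_sim_low.
have [mn|nm] := leqP m.+1 n.+1; first exact: n_step_map_sim_low.
apply: (corner_inj Ystep) (ltnW nm) _ => j [l [i [g lE]]] /=.
rewrite lE !restr_comp; congr restr; rewrite -!app_restr; apply: IH => v.
by rewrite !vertices_restr; exact: xx'.
Qed.

Lemma quotient_factor : exists g : cubeset_map Q Y, compmap g q = f.
Proof.
pose r m (c : Q m) : X m := sval (cid (quotient_map_surjective c)).
have rP m (c : Q m) : q m (r m c) = c by rewrite /r; case: cid.
have q_sim m (x x' : X m) : q m x = q m x' -> f m x = f m x'.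
  move=> xx'; apply: n_step_map_sim => v; apply/quotient_map0_eq.
  by rewrite -[LHS]/((q 0 \o vertices x) v) -vertices_app xx' vertices_app.
have gN l m (h : box_hom l m) (c : Q m) :
    f l (r l (restr h c)) = restr h (f m (r m c)).
  by rewrite -app_restr; apply: q_sim; rewrite rP app_restr rP.
exists (@CubesetMap Q Y (fun m c => f m (r m c)) gN).
by apply: cubeset_map_ext => m x; apply: q_sim; exact: rP.
Qed.

End MapsToNStep.

End ConcreteFibrant.

(** * Transport along isomorphisms *)

Lemma compmapA A B C D (h : cubeset_map C D) (g : cubeset_map B C)
  (f : cubeset_map A B) : compmap (compmap h g) f = compmap h (compmap g f).
Proof. exact: cubeset_map_ext. Qed.

Lemma compmap1f A B (f : cubeset_map A B) : compmap (idmap B) f = f.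
Proof. exact: cubeset_map_ext. Qed.

Section Transport.
Variables (Y Z : cubeset) (phi : cubeset_map Y Z) (psi : cubeset_map Z Y).
Hypotheses (psiK : compmap psi phi = idmap Y) (phiK : compmap phi psi = idmap Z).

Lemma psi_phi m (y : Y m) : psi m (phi m y) = y.
Proof. by rewrite -[LHS]/(compmap psi phi m y) psiK. Qed.

Lemma iso_concrete : concrete Z -> concrete Y.
Proof.
move=> Zc m c c' cc'; rewrite -(psi_phi c) -(psi_phi c'); congr (psi m _).
by apply: Zc; rewrite !vertices_app cc'.
Qed.

Lemma iso_surjective X (q : cubeset_map X Z) :
  surjective_map q -> surjective_map (compmap psi q).
Proof.
by move=> qS m y; have [x xE] := qS m (phi m y); exists x; rewrite /= xE psi_phi.
Qed.

Lemma iso_fibration X (q : cubeset_map X Z) :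
  fibration q -> fibration (compmap psi q).
Proof.
move=> qF k a b ab; have [|l [la ql]] := qF k a (compmap phi b).
  by rewrite compmapA -ab -!compmapA phiK compmap1f.
by exists l; split=> //; rewrite compmapA ql -compmapA psiK compmap1f.
Qed.

Lemma iso_fibrant : fibrant Z -> fibrant Y.
Proof.
move=> ZF k a b _.
have [|l [la _]] := ZF k (compmap phi a) b; first exact: map_to_point_unique.
exists (compmap psi l); split; last exact: map_to_point_unique.
by rewrite compmapA la -compmapA psiK compmap1f.
Qed.

End Transport.

Theorem mainTheorem8 (n : nat) (tau_n : truncation n) (X : cubeset) :
  concrete X -> fibrant X ->
  (exists phi : cubeset_map (tau_n X) (quotient n X),
     is_iso phi /\ compmap phi (tau_unit tau_n X) = quotient_map n X) /\
  surjective_map (tau_unit tau_n X) /\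
  fibration (tau_unit tau_n X) /\
  concrete (tau_n X) /\
  fibrant (tau_n X).
Proof.
move=> Xc Xf.
have [ext _ /(_ (quotient_map n X))] :=
  tau_adjoint tau_n X (quotient_n_step Xc Xf (n := n)).
set phi := ext _ => phiE.
have [psi psiE] := quotient_factor Xc Xf (tau_n_step tau_n X) (tau_unit tau_n X).
have psiK : compmap psi phi = idmap (tau_n X).
  apply: (bij_inj (tau_adjoint tau_n X (tau_n_step tau_n X))) => /=.
  by rewrite compmapA phiE psiE compmap1f.
have phiK : compmap phi psi = idmap (quotient n X).
  apply: cubeset_map_ext => m c; have [x <-] := quotient_map_surjective c.
  rewrite -[LHS]/(compmap phi (compmap psi (quotient_map n X)) m x).
  by rewrite psiE phiE.
split; first by exists phi; split=> //; exists psi.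
rewrite -psiE; do ![split].
- exact/(iso_surjective psiK)/quotient_map_surjective.
- exact/(iso_fibration psiK phiK)/quotient_map_fibration.
- exact/(iso_concrete psiK)/quotient_concrete.
- exact/(iso_fibrant psiK)/quotient_fibrant.
Qed.
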